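(* Let $d\ge 1$ and $k\ge 0$ be fixed integers. The sequence $\left(\left\langle {n\atop k}\right\rangle^{(d)}_q\right)_{n\ge k}$ is strongly $q$-log-concave; that is, for all integers $n\ge m>k$, the difference $$\left\langle {n\atop k}\right\rangle^{(d)}_q\left\langle {m\atop k}\right\rangle^{(d)}_q-\left\langle {n+1\atop k}\right\rangle^{(d)}_q\left\langle {m-1\atop k}\right\rangle^{(d)}_q$$ is a polynomial in $q$ with only nonnegative coefficients.
   Context: For $0\le k\le n$ the $q$-analog of the $d$-Hoggatt numbers is $$\left\langle {n\atop k}\right\rangle^{(d)}_q:=q^{d\binom{k}{2}}\prod_{j=0}^{d-1}\frac{\left[{n+j\atop k}\right]_q}{\left[{k+j\atop k}\right]_q},$$ where $\left[{n\atop k}\right]_q:=\frac{[n]_q!}{[k]_q![n-k]_q!}$ is the $q$-binomial coefficient, with $[m]_q:=\frac{1-q^m}{1-q}$ and $[m]_q!:=[1]_q[2]_q\cdots[m]_q$. A sequence $(a_i(q))$ of polynomials over $\mathbb{R}$ is strongly $q$-log-concave if $a_i(q)a_j(q)-a_{i+1}(q)a_{j-1}(q)\in\mathbb{R}_{\ge 0}[q]$ for all indices $i\ge j$ for which $i+1$ and $j-1$ are also in the index range. *)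

(* Defs.v *)
From mathcomp Require Import all_boot all_order all_algebra.
From mathcomp Require Import reals.

Set Implicit Arguments.
Unset Strict Implicit.
Unset Printing Implicit Defensive.

Import Order.TTheory GRing.Theory Num.Theory.
Local Open Scope ring_scope.

Notation "x %:F" := (@FracField.tofrac _ x) : ring_scope.

(* The quotients below are taken in the field R(q) of rational functions. *)
Definition qvar (R : realType) : {fraction {poly R}} := 'X%:F.

Definition qnum (R : realType) (m : nat) : {fraction {poly R}} :=
  (1 - qvar R ^+ m) / (1 - qvar R).

Definition qfact (R : realType) (m : nat) : {fraction {poly R}} :=
  \prod_(1 <= i < m.+1) qnum R i.

(* Only meaningful for k <= n, because n - k is truncated. *)
Definition qbinom (R : realType) (n k : nat) : {fraction {poly R}} :=
  qfact R n / (qfact R k * qfact R (n - k)).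

(* Only meaningful for k <= n, like qbinom. *)
Definition hoggatt (R : realType) (d n k : nat) : {fraction {poly R}} :=
  qvar R ^+ (d * 'C(k, 2)) *
  \prod_(0 <= j < d) (qbinom R (n + j) k / qbinom R (k + j) k).

(* The index range is I.  The larger index is i and the smaller one is j.+1,
   so that the predecessor of the smaller index is j, without truncation. *)
Definition strongly_q_log_concave (R : realType) (I : pred nat)
    (a : nat -> {poly R}) : Prop :=
  forall i j : nat, (j.+1 <= i)%N -> I i -> I j.+1 -> I i.+1 -> I j ->
    a i * a j.+1 - a i.+1 * a j \is a polyOver Num.nneg.

(* Main.v *)
Require Import Defs.
From mathcomp Require Import all_boot all_order all_algebra.
From mathcomp Require Import reals.
From mathcomp Require Import zify ring.

(** The proof gives the Hoggatt numbers a combinatorial meaning, for which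
    log-concavity becomes an injection.

    Put n = k + r.  The q-binomial quotients telescope, and the number is, up
    to the factor q^(d C(k,2)), the product over 0 <= j < d and 0 <= i < k of
    (1 - q^(k+j-i+r)) / (1 - q^(k+j-i)) ([hoggatt_box_prod]): MacMahon's
    generating function of the plane partitions in a k x d x r box.  Up to a
    power of q it is the Schur function of the d x r rectangle at
    1, q, ..., q^(k+d-1), that is, the sum of q^(sum of the entries below the
    top row) over the Gelfand-Tsetlin patterns whose top row is k zeros followed
    by d copies of r.  The product formula for any weakly increasing top row
    [lam] ([gt_gf_vdm]) goes by induction on the number of rows.  The entries of
    the row under [lam] range independently over intervals, so a Vandermonde
    determinant summed over this row is a determinant of geometric sums; these
    telescope, and what remains is the next Vandermonde determinant, with
    adjacent columns subtracted.

    For a rectangular top row the patterns are the order-preserving maps f from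
    a finite set with a relation to {0, ..., r}, with f = 0 on a set Z and f = r
    on a set W.  Let N_r be the generating function of these maps by the sum of their
    values.  For s < r, the difference N_r N_(s+1) - N_(r+1) N_s has
    nonnegative coefficients ([op_gf_strong_log_concave]), because a
    weight-preserving injection sends a pair (a, b) with bounds r+1 and s to a
    pair with bounds s+1 and r: it replaces (a, b) by (b+1, a-1) at the points
    outside a region that contains all zeros of a.  The region is the union of
    the classes, meeting a zero of a, of the equivalence relation generated by
    the pairs of points at which exchanging at only one point would break
    monotonicity.  The same region is found from the image, so the exchange is
    an involution.

    The power of q that separates N_r from the box product is
    q^(r (0 + 1 + ... + (d-1))).  Its exponent is linear in r, so that both
    products in the difference contain the same power, which can be cancelled
    without changing the signs of the coefficients. *)

Set Implicit Arguments.
Unset Strict Implicit.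
Unset Printing Implicit Defensive.

Import Order.TTheory GRing.Theory Num.Theory.
Local Open Scope ring_scope.

(** * Exchanging two order-preserving maps outside a region *)

Section Exchange.
Local Open Scope nat_scope.
Variables (P : finType) (e : rel P).
Implicit Types a b : P -> nat.

(** With b raised by 1, this says that the intervals [a p, a q] and
    [b p + 1, b q + 1] are disjoint, which is exactly when exchanging at only
    one of p, q destroys an inequality. *)
Definition clash a b p q := (a q <= b p) || ((b q).+1 < a p).

Definition clash_edge a b : rel P :=
  [rel p q | e p q && clash a b p q || e q p && clash a b q p].

Definition zero_region a b p :=
  [exists z, (a z == 0) && connect (clash_edge a b) z p].

(** Both [exch1] and [exch2] keep the region and exchange a with b + 1 outside
    it; the second component is then lowered by 1, so that the two upper bounds
    are interchanged up to a shift by 1. *)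
Definition exch1 a b p := if zero_region a b p then a p else (b p).+1.
Definition exch2 a b p := if zero_region a b p then b p else (a p).-1.

Definition monotone a := forall p q, e p q -> a p <= a q.

Lemma zero_in_region a b p : a p = 0 -> zero_region a b p.
Proof. by move=> a0; apply/existsP; exists p; rewrite a0 connect0. Qed.

Lemma zero_region_closed a b p q :
  clash_edge a b p q -> zero_region a b p = zero_region a b q.
Proof.
have sub x y : clash_edge a b x y -> zero_region a b x -> zero_region a b y.
  move=> exy /existsP[z /andP[az zx]]; apply/existsP; exists z.
  by rewrite az (connect_trans zx) ?connect1.
move=> epq; apply/idP/idP; first exact: sub.
by apply: sub; rewrite /clash_edge /= orbC.
Qed.

Lemma zero_region_no_clash a b p q :
  e p q -> zero_region a b p != zero_region a b q -> ~~ clash a b p q.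
Proof.
move=> epq; apply: contra => cpq; apply/eqP/zero_region_closed.
by rewrite /clash_edge /= epq cpq.
Qed.

(** Along a clash the two intervals are disjoint, so a stays on the same side of
    b + 1; at the zeros of a it lies below.  This keeps the region away from the
    points where a is forced to its maximal value. *)
Lemma zero_region_le a b p :
  monotone a -> monotone b -> zero_region a b p -> a p <= b p.
Proof.
move=> ma mb /existsP[z /andP[/eqP az zp]].
have cl : closed (clash_edge a b) [pred x | a x <= b x].
  move=> x y /= /orP[] /andP[exy cxy]; rewrite !inE.
    by have := ma _ _ exy; have := mb _ _ exy; move: cxy; rewrite /clash; lia.
  by have := ma _ _ exy; have := mb _ _ exy; move: cxy; rewrite /clash; lia.
by have := closed_connect cl zp; rewrite !inE az leq0n => <-.
Qed.

Lemma zero_region_ext a b a' b' :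
  a =1 a' -> b =1 b' -> zero_region a b =1 zero_region a' b'.
Proof.
move=> Ea Eb p; apply: eq_existsb => z; rewrite Ea; congr andb.
by apply: eq_connect => x y; rewrite /clash_edge /clash /= !Ea !Eb.
Qed.

Lemma exch1_ext a b a' b' : a =1 a' -> b =1 b' -> exch1 a b =1 exch1 a' b'.
Proof. by move=> Ea Eb p; rewrite /exch1 (zero_region_ext Ea Eb) Ea Eb. Qed.

Lemma exch2_ext a b a' b' : a =1 a' -> b =1 b' -> exch2 a b =1 exch2 a' b'.
Proof. by move=> Ea Eb p; rewrite /exch2 (zero_region_ext Ea Eb) Ea Eb. Qed.

Lemma outside_region_gt0 a b p : ~~ zero_region a b p -> 0 < a p.
Proof. by rewrite lt0n; apply: contra => /eqP/zero_in_region->. Qed.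

(** Where only one of two related points lies in the region they do not clash,
    and overlapping intervals can have their ends exchanged. *)
Lemma exch_monotone a b :
  monotone a -> monotone b -> monotone (exch1 a b) /\ monotone (exch2 a b).
Proof.
move=> ma mb; split=> p q epq; have := ma _ _ epq; have := mb _ _ epq;
  have := zero_region_no_clash (a := a) (b := b) epq; rewrite /exch1 /exch2 /clash;
  move: (@outside_region_gt0 a b p) (@outside_region_gt0 a b q);
  case: (zero_region a b p); case: (zero_region a b q) => //=; lia.
Qed.

(** The clash condition is symmetric under exchanging a with b + 1, hence keeps
    its value when both points are outside the region; when only one is, it was
    false and stays false.  Zeros of the new first map lie in the region, where
    the map is unchanged. *)
Lemma zero_region_exch a b : monotone a -> monotone b ->
  zero_region (exch1 a b) (exch2 a b) =1 zero_region a b.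
Proof.
move=> ma mb.
have Ec p q : e p q -> clash (exch1 a b) (exch2 a b) p q = clash a b p q.
  move=> epq; have := ma _ _ epq; have := mb _ _ epq.
  have := zero_region_no_clash (a := a) (b := b) epq; rewrite /exch1 /exch2 /clash.
  move: (@outside_region_gt0 a b p) (@outside_region_gt0 a b q).
  case: (zero_region a b p); case: (zero_region a b q) => //=; lia.
move=> p; apply: eq_existsb => z; congr andb.
  rewrite /exch1; case: ifPn => // zr.
  by rewrite -[a z == 0]negbK -lt0n (outside_region_gt0 zr).
apply: eq_connect => x y; rewrite /clash_edge /=.
by case exy: (e x y); case eyx: (e y x); rewrite //= ?Ec.
Qed.

(** The exchange is an involution because the region is recovered from its
    result; this is what makes it injective on pairs. *)
Lemma exchK a b : monotone a -> monotone b ->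
  exch1 (exch1 a b) (exch2 a b) =1 a /\ exch2 (exch1 a b) (exch2 a b) =1 b.
Proof.
move=> ma mb; have E := zero_region_exch ma mb.
split=> p; rewrite /exch1 /exch2 E; case zr: (zero_region a b p) => //=.
by rewrite prednK // (@outside_region_gt0 a b) ?zr.
Qed.

Lemma exch_sum a b p : exch1 a b p + exch2 a b p = a p + b p.
Proof.
rewrite /exch1 /exch2; case: ifPn => // /outside_region_gt0; lia.
Qed.

End Exchange.

(** * Log-concavity for generating functions of order-preserving maps *)

Lemma sum_Xn_inj_nneg (R : realType) (T U : finType) (A : {set T}) (B : {set U})
    (phi : T -> U) (wA : T -> nat) (wB : U -> nat) :
  {in A &, injective phi} ->
  (forall t, t \in A -> phi t \in B /\ wB (phi t) = wA t) ->
  (\sum_(u in B) 'X^(wB u) : {poly R}) - \sum_(t in A) 'X^(wA t)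
    \is a polyOver Num.nneg.
Proof.
move=> phi_inj phiAB.
have subAB : phi @: A \subset B.
  by apply/subsetP=> _ /imsetP[t /phiAB[? _] ->].
rewrite (big_setID (phi @: A)) /= (setIidPr subAB) big_imset //=.
have -> : \sum_(t in A) 'X^(wB (phi t)) = \sum_(t in A) 'X^(wA t) :> {poly R}.
  by apply: eq_bigr => t /phiAB[_ ->].
rewrite addrAC subrr add0r; apply/polyOverP => i.
by rewrite coef_sum nnegrE sumr_ge0 // => u _; rewrite coefXn ler0n.
Qed.

Section OrderPreserving.
Variables (R : realType) (P : finType) (e : rel P) (Z W : pred P).

(** Z and W stand for the cells of a pattern that lie under two adjacent equal
    entries of a rectangular top row, where the value is forced. *)
Definition op_maps r :=
  [set f : {ffun P -> 'I_r.+1} | [forall p, forall q, e p q ==> (f p <= f q)%N] &&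
    [forall p, ((if W p then r else 0) <= f p <= if Z p then 0 else r)%N]].

Definition op_gf r : {poly R} :=
  \sum_(f in op_maps r) 'X^(\sum_p (f p : nat))%N.

Lemma op_mapsP r (f : {ffun P -> 'I_r.+1}) :
  reflect (monotone e (fun p => f p : nat) /\
    forall p, ((if W p then r else 0) <= f p <= if Z p then 0 else r)%N)
  (f \in op_maps r).
Proof.
rewrite inE; apply: (iffP andP) => -[mf bf]; split.
- by move=> p q epq; move/forallP/(_ p)/forallP/(_ q)/implyP/(_ epq): mf.
- exact/forallP.
- by apply/forallP=> p; apply/forallP=> q; apply/implyP; apply: mf.
- exact/forallP.
Qed.

Lemma op_gfM r s : op_gf r * op_gf s =
  \sum_(fg in setX (op_maps r) (op_maps s))
    'X^(\sum_p (fg.1 p + fg.2 p))%N.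
Proof.
rewrite big_distrl /=.
under eq_bigr => f _.
  rewrite big_distrr /=.
  under eq_bigr => g _ do rewrite -exprD -big_split /=.
  over.
by rewrite pair_big /=; apply: eq_bigl => -[f g]; rewrite in_setX.
Qed.

(** The exchange maps the pairs counted by the second product injectively to
    those counted by the first, with the same total weight.  On Z the first map
    vanishes, so Z lies in the region; on W the first map exceeds the second, so
    W lies outside; hence the boundary values of the image are the right ones. *)
Lemma op_gf_strong_log_concave r s : (s < r)%N ->
  op_gf r * op_gf s.+1 - op_gf r.+1 * op_gf s \is a polyOver Num.nneg.
Proof.
move=> sr; rewrite [op_gf r * _]mulrC !op_gfM.
pose v r (f : {ffun P -> 'I_r.+1}) p : nat := f p.
pose phi (fg : {ffun P -> 'I_r.+2} * {ffun P -> 'I_s.+1}) :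
    {ffun P -> 'I_s.+2} * {ffun P -> 'I_r.+1} :=
  ([ffun p => inord (exch1 e (v _ fg.1) (v _ fg.2) p)],
   [ffun p => inord (exch2 e (v _ fg.1) (v _ fg.2) p)]).
have bounds f g : f \in op_maps r.+1 -> g \in op_maps s -> forall p,
    ((if W p then s.+1 else 0) <= exch1 e (v _ f) (v _ g) p
      <= if Z p then 0 else s.+1)%N /\
    ((if W p then r else 0) <= exch2 e (v _ f) (v _ g) p
      <= if Z p then 0 else r)%N.
  move=> /op_mapsP[mf bf] /op_mapsP[mg bg] p.
  have := bf p; have := bg p; rewrite /exch1 /exch2.
  have := @zero_region_le _ e (v _ f) (v _ g) p mf mg.
  have := @zero_in_region _ e (v _ f) (v _ g) p.
  rewrite -/(v _ f p) -/(v _ g p).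
  case: (zero_region _ _ _ p); case: (W p); case: (Z p) => //=; lia.
have phi1 f g : f \in op_maps r.+1 -> g \in op_maps s ->
    v _ (phi (f, g)).1 =1 exch1 e (v _ f) (v _ g).
  move=> fX gX p; have [/andP[_ up] _] := bounds _ _ fX gX p.
  rewrite /v /= ffunE inordK // ltnS (leq_trans up) //; by case: ifP.
have phi2 f g : f \in op_maps r.+1 -> g \in op_maps s ->
    v _ (phi (f, g)).2 =1 exch2 e (v _ f) (v _ g).
  move=> fX gX p; have [_ /andP[_ up]] := bounds _ _ fX gX p.
  rewrite /v /= ffunE inordK // ltnS (leq_trans up) //; by case: ifP.
apply: (@sum_Xn_inj_nneg R _ _ _ _ phi).
  move=> [f g] [f' g']; rewrite !in_setX /= => /andP[fX gX] /andP[f'X g'X] E.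
  have [[mf _] [mg _]] := (op_mapsP _ fX, op_mapsP _ gX).
  have [[mf' _] [mg' _]] := (op_mapsP _ f'X, op_mapsP _ g'X).
  have E1 : exch1 e (v _ f) (v _ g) =1 exch1 e (v _ f') (v _ g').
    by move=> p; rewrite -phi1 // E phi1.
  have E2 : exch2 e (v _ f) (v _ g) =1 exch2 e (v _ f') (v _ g').
    by move=> p; rewrite -phi2 // E phi2.
  have [K1 K2] := exchK mf mg; have [K1' K2'] := exchK mf' mg'.
  congr pair; apply/ffunP=> p; apply: val_inj.
    by rewrite -[LHS]K1 -[RHS]K1'; apply: exch1_ext.
  by rewrite -[LHS]K2 -[RHS]K2'; apply: exch2_ext.
move=> [f g]; rewrite in_setX /= => /andP[fX gX].
have [[mf _] [mg _]] := (op_mapsP _ fX, op_mapsP _ gX).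
have [m1 m2] := exch_monotone mf mg.
split.
  rewrite in_setX; apply/andP; split; apply/op_mapsP; split=> [p q epq|p].
  - by have := m1 _ _ epq; rewrite -!phi1.
  - by have [+ _] := bounds _ _ fX gX p; rewrite -phi1.
  - by have := m2 _ _ epq; rewrite -!phi2.
  - by have [_ +] := bounds _ _ fX gX p; rewrite -phi2.
apply: eq_bigr => p _.
rewrite -[LHS]/(v _ (phi (f, g)).1 p + v _ (phi (f, g)).2 p)%N.
by rewrite phi1 // phi2 // exch_sum.
Qed.
End OrderPreserving.

(** * Vandermonde determinants *)

Section Vandermonde.
Variable R : comNzRingType.

Definition vdm n (x : nat -> R) := \prod_(j < n) \prod_(i < j) (x j - x i).

Lemma vdmS n x : vdm n.+1 x = vdm n x * \prod_(i < n) (x n - x i).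
Proof. by rewrite /vdm big_ord_recr. Qed.

Lemma det_vdm n (x : nat -> R) : \det (\matrix_(i < n, j < n) x j ^+ i) = vdm n x.
Proof.
transitivity (\det (Vandermonde n (\row_(j < n) x j))).
  by congr determinant; apply/matrixP=> i j; rewrite !mxE.
rewrite det_Vandermonde (exchange_big_dep predT) //=.
apply: eq_bigr => j _; under eq_bigr => i _ do rewrite !mxE.
rewrite (big_ord_widen_cond n predT (fun i => x j - x i) (ltnW (ltn_ord j))).
exact: eq_bigl.
Qed.

(** Subtract from each column of the Vandermonde matrix of size n + 1 the
    column before it; the first row becomes (1, 0, ..., 0). *)
Lemma det_vdm_diff n (x : nat -> R) :
  \det (\matrix_(i < n, j < n) (x j.+1 ^+ i.+1 - x j ^+ i.+1)) = vdm n.+1 x.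
Proof.
pose A : 'M_n.+1 := \matrix_(i, j) x j ^+ i.
(* Right multiplication by U subtracts from each column the one before. *)
pose U : 'M[R]_n.+1 := \matrix_(l, j) ((l == j)%:R - (l.+1 == j :> nat)%:R).
have detU : \det U = 1.
  rewrite -det_tr det_trig.
    by apply: big1 => i _; rewrite !mxE eqxx (gtn_eqF (ltnSn i)) subr0.
  apply/is_trig_mxP => i j ij; rewrite !mxE -val_eqE /=.
  by rewrite !gtn_eqF ?subr0 // ltnS ltnW.
have AU0 i : (A *m U) i ord0 = x 0 ^+ i.
  rewrite mxE (bigD1 ord0) //= big1 ?addr0 => [|l l0]; rewrite !mxE /=.
    by rewrite subr0 mulr1.
  by rewrite (negPf l0) subr0 mulr0.
have AUS i (j : 'I_n) : (A *m U) i (lift ord0 j) = x j.+1 ^+ i - x j ^+ i.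
  have jS : lift ord0 j != widen_ord (leqnSn n) j.
    by rewrite -val_eqE /= /bump /= gtn_eqF.
  rewrite mxE (bigD1 (lift ord0 j)) //= (bigD1 (widen_ord (leqnSn n) j)) 1?eq_sym //=.
  rewrite big1 ?addr0 => [|l /andP[l1 l2]]; rewrite !mxE.
    rewrite eqxx /= /bump /= !add1n eqxx (gtn_eqF (ltnSn j.+1)) eq_sym (negPf jS).
    by rewrite subr0 sub0r mulr1 mulrN1.
  rewrite (negPf l1) /= /bump /= add1n eqSS -val_eqE /= in l2 *.
  by rewrite (negPf l2) subr0 mulr0.
rewrite -det_vdm -/A -[LHS]mul1r -[RHS]mulr1 -detU -det_mulmx.
rewrite detU mul1r (expand_det_row _ ord0) big_ord_recl big1 ?addr0 => [|j _]; last first.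
  by rewrite AUS !expr0 subrr mul0r.
rewrite AU0 expr0 mul1r /cofactor addn0 expr0 mul1r.
by congr determinant; apply/matrixP => i j; rewrite mxE [RHS]mxE [RHS]mxE AUS.
Qed.

(** Multilinearity of the determinant in its columns, in the form of
    distributing a product of sums. *)
Lemma det_sum_rows n (T : finType) (Q : 'I_n -> pred T) (F : 'I_n -> 'I_n -> T -> R) :
  \det (\matrix_(i, j) \sum_(t | Q j t) F i j t) =
  \sum_(h in family Q) \det (\matrix_(i, j) F i j (h j)).
Proof.
rewrite -det_tr; under [in RHS]eq_bigr do rewrite -det_tr.
rewrite /determinant exchange_big /=; apply: eq_bigr => s _.
rewrite -big_distrr /=; congr (_ * _).
under [LHS]eq_bigr do rewrite !mxE.
rewrite bigA_distr_big_dep; apply: eq_bigr => h _.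
by apply: eq_bigr => i _; rewrite !mxE.
Qed.

End Vandermonde.

(** * Gelfand-Tsetlin patterns, row by row *)

Section JoinFfun.
Variables (A B : finType) (X : Type).
Definition joinf (g : {ffun A -> X}) (h : {ffun B -> X}) : {ffun A + B -> X} :=
  [ffun p => match p with inl x => g x | inr y => h y end].
End JoinFfun.

Lemma sum_joinf (V : nmodType) (A B X : finType) (F : {ffun A + B -> X} -> V) :
  \sum_f F f = \sum_g \sum_h F (joinf g h).
Proof.
rewrite pair_big /= (reindex (fun gh => joinf gh.1 gh.2)) //=.
exists (fun f => ([ffun x => f (inl x)], [ffun y => f (inr y)])) => [[g h]|f] _ /=.
  by congr pair; apply/ffunP => x; rewrite !ffunE.
by apply/ffunP => -[x|y]; rewrite !ffunE.
Qed.

(** The cells of a triangle with rows of lengths 0, ..., n - 1.  The recursion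
    by sum types lets a sum over fillings split off its last row. *)
Fixpoint tri n : finType :=
  if n is m.+1 then (tri m + 'I_m)%type else void.

Fixpoint tri_coord n : tri n -> nat * nat :=
  match n with
  | 0 => fun p => match p : void with end
  | m.+1 => fun p => match p with inl p' => tri_coord p' | inr j => (m, val j) end
  end.

(** The interlacing inequalities: cell (i, j), in a row of length i, lies
    between the cells (i + 1, j) and (i + 1, j + 1) of the next row. *)
Definition below (u v : nat * nat) : bool :=
  ((u.1 == v.1.+1) && (u.2 == v.2) || (v.1 == u.1.+1) && (v.2 == u.2.+1))%N.

Lemma tri_coord_bounds n (p : tri n) : ((tri_coord p).2 < (tri_coord p).1 < n)%N.
Proof.
elim: n p => [[]|n IH] [p|j] /=; last by rewrite ltn_ord ltnSn.
by have /andP[-> /ltnW] := IH p.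
Qed.

Section GT.
Variable r : nat.
Implicit Type lam : nat -> nat.

(** The top row [lam], of length n, is not part of the filling; it only bounds
    the row of length n - 1.  Thus each row can in turn play the role of the
    top row for the rows before it. *)
Definition gt_pattern n lam (f : {ffun tri n -> 'I_r.+1}) : bool :=
  [forall p, forall q, below (tri_coord p) (tri_coord q) ==> (f p <= f q)%N] &&
  [forall p, ((tri_coord p).1.+1 == n) ==>
     (lam (tri_coord p).2 <= f p <= lam (tri_coord p).2.+1)%N].

Lemma gt_patternP n lam (f : {ffun tri n -> 'I_r.+1}) :
  reflect ((forall p q, below (tri_coord p) (tri_coord q) -> (f p <= f q)%N) /\
    (forall p, (tri_coord p).1.+1 = n -> (lam (tri_coord p).2 <= f p <= lam (tri_coord p).2.+1)%N))
  (gt_pattern lam f).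
Proof.
apply: (iffP andP) => -[mf bf]; split.
- by move=> p q epq; move/forallP/(_ p)/forallP/(_ q)/implyP/(_ epq): mf.
- by move=> p /eqP Ep; move/forallP/(_ p)/implyP/(_ Ep): bf.
- by apply/forallP=> p; apply/forallP=> q; apply/implyP; apply: mf.
- by apply/forallP=> p; apply/implyP => /eqP; apply: bf.
Qed.

Definition row_of n (h : {ffun 'I_n -> 'I_r.+1}) (j : nat) : nat :=
  oapp (fun i => val (h i)) 0%N (insub j).

Lemma row_ofE n (h : {ffun 'I_n -> 'I_r.+1}) (j : 'I_n) : row_of h j = h j.
Proof. by rewrite /row_of valK. Qed.

(** The row under the top row ranges over a product of intervals, and given
    this row, the rest is any pattern below it. *)
Lemma gt_pattern_join n lam (g : {ffun tri n -> 'I_r.+1}) (h : {ffun 'I_n -> 'I_r.+1}) :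
  gt_pattern (n := n.+1) lam (joinf g h) =
  (h \in family (fun j : 'I_n => [pred m : 'I_r.+1 | lam j <= m <= lam j.+1]%N))
  && gt_pattern (row_of h) g.
Proof.
apply/gt_patternP/andP => [[mono top]|[/familyP hX /gt_patternP[mono top]]].
  split; first by apply/familyP=> j; have := top (inr j); rewrite ffunE inE; apply.
  apply/gt_patternP; split=> [p q pq|p Ep].
    by have := mono (inl p) (inl q) pq; rewrite !ffunE.
  have /andP[jp pn] := tri_coord_bounds p.
  have jn : ((tri_coord p).2.+1 < n)%N by lia.
  rewrite -[(tri_coord p).2]/(val (Ordinal (ltnW jn))) -[_.+1]/(val (Ordinal jn)) !row_ofE.
  have lo : below (@tri_coord n.+1 (inr (Ordinal (ltnW jn)))) (tri_coord p).
    by rewrite /below /= Ep !eqxx.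
  have up : below (tri_coord p) (@tri_coord n.+1 (inr (Ordinal jn))).
    by rewrite /below /= Ep !eqxx orbT.
  have := mono (inr (Ordinal (ltnW jn))) (inl p) lo.
  have := mono (inl p) (inr (Ordinal jn)) up.
  by rewrite !ffunE => -> ->.
split=> [[p|i] [q|j]|[p|j]] /=; rewrite ?ffunE.
- exact: mono.
- have /andP[_ pn] := tri_coord_bounds p => /orP[] /= /andP[/eqP E1 /eqP E2]; first by lia.
  have /andP[_] := top p (esym E1); by rewrite -E2 row_ofE.
- have /andP[_ pn] := tri_coord_bounds q => /orP[] /= /andP[/eqP E1 /eqP E2]; last by lia.
  have /andP[+ _] := top q (esym E1); by rewrite -E2 row_ofE.
- by rewrite /below /= => /orP[] /andP[/eqP]; lia.
- by have /andP[_ pn] := tri_coord_bounds p => -[]; lia.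
- by move=> _; have := hX j; rewrite inE.
Qed.

End GT.

(** * The product formula for Gelfand-Tsetlin patterns *)

Lemma det_scale_rows (S : comNzRingType) n (a : 'I_n -> S) (M : 'I_n -> 'I_n -> S) :
  \det (\matrix_(i, j) (a i * M i j)) = (\prod_i a i) * \det (\matrix_(i, j) M i j).
Proof.
transitivity (\det (diag_mx (\row_i a i) *m \matrix_(i, j) M i j)).
  by congr determinant; apply/matrixP=> i j; rewrite mul_diag_mx !mxE.
by rewrite det_mulmx det_diag; congr (_ * _); apply: eq_bigr => i _; rewrite mxE.
Qed.

Lemma det_scale_cols (S : comNzRingType) n (b : 'I_n -> S) (M : 'I_n -> 'I_n -> S) :
  \det (\matrix_(i, j) (b j * M i j)) = (\prod_j b j) * \det (\matrix_(i, j) M i j).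
Proof.
rewrite -det_tr -[in RHS]det_tr.
transitivity (\det (\matrix_(i, j) (b i * M j i))).
  by congr determinant; apply/matrixP=> i j; rewrite !mxE.
rewrite det_scale_rows; congr (_ * _).
by congr determinant; apply/matrixP=> i j; rewrite !mxE.
Qed.

Lemma geometric_sum_ord (S : comNzRingType) (y : S) r a b :
  (a <= b <= r)%N ->
  (y - 1) * (\sum_(t < r.+1 | (a <= t <= b)%N) y ^+ t) = y ^+ b.+1 - y ^+ a.
Proof.
move=> /andP[ab br].
rewrite -(big_mkord (fun t => a <= t <= b)%N (fun t => y ^+ t)).
have -> : \sum_(0 <= t < r.+1 | (a <= t <= b)%N) y ^+ t = \sum_(a <= t < b.+1) y ^+ t.
  rewrite [RHS](big_nat_widen _ _ r.+1) // [RHS](big_nat_widenl _ 0) //.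
  by apply: eq_bigl => t /=; rewrite ltnS andbC.
rewrite big_distrr /= -telescope_sumr ?leqW //.
by apply: eq_bigr => t _; rewrite mulrBl mul1r exprS.
Qed.

(** The factor by which the denominator grows from n to n + 1: a power of y,
    and the denominators of n geometric sums. *)
Lemma vdm_powersS (S : comNzRingType) (y : S) n :
  vdm n.+1 (fun j => y ^+ j) =
  vdm n (fun j => y ^+ j) *
    ((\prod_(i < n) y ^+ i) * \prod_(i < n) (y ^+ i.+1 - 1)).
Proof.
rewrite vdmS; congr (_ * _).
rewrite [\prod_(i < n) (y ^+ i.+1 - 1)](reindex_inj rev_ord_inj) -big_split /=.
apply: eq_bigr => i _; rewrite mulrBr mulr1 -exprD.
by congr (y ^+ _ - _); have := ltn_ord i; lia.
Qed.

Section GTgf.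
Variable R : realType.
Implicit Type lam : nat -> nat.

Definition gt_gf r n lam : {poly R} :=
  \sum_(f : {ffun tri n -> 'I_r.+1} | gt_pattern lam f) 'X^(\sum_p f p)%N.

Lemma gt_gfS r n lam :
  gt_gf r n.+1 lam =
  \sum_(h in family (fun j : 'I_n => [pred m : 'I_r.+1 | lam j <= m <= lam j.+1]%N))
    'X^(\sum_j h j)%N * gt_gf r n (row_of h).
Proof.
rewrite /gt_gf big_mkcond sum_joinf exchange_big [RHS]big_mkcond /=.
apply: eq_bigr => h _; case: ifPn => hX; last first.
  by apply: big1 => g _; rewrite gt_pattern_join (negPf hX).
rewrite [X in _ * X]big_mkcond big_distrr /=; apply: eq_bigr => g _.
rewrite gt_pattern_join hX /=; case: ifP => _; last by rewrite mulr0.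
rewrite -exprD big_sumType /= addnC.
by congr ('X^(_ + _)); apply: eq_bigr => p _; rewrite ffunE.
Qed.

(** The principal specialization of the Schur function of [lam], as a ratio of
    Vandermonde products.  With x_j = q^(lam j + j), the sum over the row
    interlacing with [lam] turns q^(sum of the row) times the Vandermonde
    determinant of that row into a determinant of geometric sums
    (x_(j+1)^(i+1) - x_j^(i+1)) / (q^(i+1) - 1). *)
Lemma gt_gf_vdm r n lam :
  (forall j, (j < n)%N -> (lam j <= r)%N) ->
  (forall j, (j.+1 < n)%N -> (lam j <= lam j.+1)%N) ->
  vdm n (fun j => 'X^j) * gt_gf r n lam = vdm n (fun j => 'X^(lam j + j)%N).
Proof.
elim: n lam => [|n IH] lam lamr lamS.
  have -> : gt_gf r 0 lam = 1.
    rewrite /gt_gf (eq_bigl predT) => [|f].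
      rewrite (eq_bigr (fun=> 1)) => [|f _]; last by rewrite big_pred0 ?expr0 // => -[].
      by rewrite sumr_const card_ffun card_void expn0.
    by apply/gt_patternP; split=> -[].
  by rewrite mulr1 /vdm !big_ord0.
rewrite vdm_powersS gt_gfS -det_vdm_diff mulrA.
pose E (i j : 'I_n) (t : 'I_r.+1) : {poly R} := 'X^((t + j) * i.+1).
transitivity ((\prod_(i < n) ('X^(i.+1) - 1)) * \det (\matrix_(i, j)
   \sum_(t | [pred m : 'I_r.+1 | lam j <= m <= lam j.+1]%N t) E i j t)); last first.
  rewrite -det_scale_rows; congr determinant; apply/matrixP=> i j; rewrite !mxE.
  have -> : \sum_(t < r.+1 | (lam j <= t <= lam j.+1)%N) E i j t =
     'X^(j * i.+1) * \sum_(t < r.+1 | (lam j <= t <= lam j.+1)%N) 'X^(i.+1) ^+ t.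
    rewrite big_distrr /=; apply: eq_bigr => t _.
    by rewrite /E -exprM -exprD; congr ('X^_); nia.
  rewrite mulrCA geometric_sum_ord.
    by rewrite mulrBr -!exprM -!exprD; congr ('X^_ - 'X^_); nia.
  by rewrite lamS ?lamr // ltnS ltn_ord.
rewrite det_sum_rows [_ * \prod_(i < n) ('X^(i.+1) - 1)]mulrC -mulrA; congr (_ * _).
rewrite big_distrr /=; apply: eq_bigr => h /familyP hX.
have hl (j : 'I_n) : (lam j <= h j <= lam j.+1)%N by have := hX j; rewrite inE.
rewrite ['X^_ * gt_gf _ _ _]mulrC mulrACA IH; first last.
- move=> j jn; have := hl (Ordinal jn); have := hl (Ordinal (ltnW jn)).
  by rewrite -!row_ofE /=; lia.
- by move=> j jn; rewrite (row_ofE h (Ordinal jn)) -ltnS.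
(* The powers of q from [vdm_powersS] and from the row h scale column j by
   q^(h j + j), which raises every exponent i in it to i + 1. *)
rewrite mulrC -det_vdm expr_sum -big_split /= -det_scale_cols.
congr determinant; apply/matrixP=> i j; rewrite !mxE /E row_ofE -exprM -!exprD.
by congr ('X^_); nia.
Qed.
End GTgf.

(** * Rectangular top rows *)

Section Box.
Variable R : realType.

Lemma vdm_split (S : comNzRingType) k d (x : nat -> S) :
  vdm (k + d) x = vdm k x *
   \prod_(j < d) ((\prod_(i < k) (x (k + j)%N - x i)) *
                  \prod_(i < j) (x (k + j)%N - x (k + i)%N)).
Proof.
elim: d => [|d IH]; first by rewrite addn0 big_ord0 mulr1.
by rewrite addnS vdmS IH big_ord_recr /= mulrA big_split_ord.
Qed.

Definition rect_row k r j : nat := if (j < k)%N then 0 else r.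

Definition box_prod k d r : {poly R} :=
  \prod_(j < d) \prod_(i < k) (1 - 'X^(k + j - i + r)).

(** In the ratio of Vandermonde products, the pairs inside the zero block of the
    top row contribute 1, those inside the block of r contribute q^r each, and
    the mixed pairs give the box product. *)
Lemma vdm_rect k d r :
  vdm (k + d) (fun j => 'X^(rect_row k r j + j)) * box_prod k d 0 =
  vdm (k + d) (fun j => 'X^j) * ('X^(r * \sum_(j < d) j) * box_prod k d r).
Proof.
have x_lo (i : 'I_k) : rect_row k r i = 0%N by rewrite /rect_row ltn_ord.
have x_hi j : rect_row k r (k + j) = r by rewrite /rect_row ltnNge leq_addr.
rewrite !vdm_split -!mulrA; congr (_ * _).
  apply: eq_bigr => j _; apply: eq_bigr => i _.
  by rewrite /rect_row (ltn_trans (ltn_ord i)) ltn_ord.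
rewrite big_distrr expr_sum /box_prod -!big_split /=; apply: eq_bigr => j _.
have -> : \prod_(i < j) ('X^(rect_row k r (k + j) + (k + j)) -
    'X^(rect_row k r (k + i) + (k + i))) =
   'X^(r * j) * \prod_(i < j) ('X^(k + j) - 'X^(k + i)) :> {poly R}.
  under eq_bigr => i _ do rewrite !x_hi !exprD -mulrBr -!exprD.
  by rewrite big_split /= prodr_const card_ord -exprM.
have factor s : \prod_(i < k) ('X^(s + (k + j)) - 'X^i) =
    (\prod_(i < k) - 'X^i) * \prod_(i < k) (1 - 'X^(k + j - i + s)) :> {poly R}.
  rewrite -big_split /=; apply: eq_bigr => i _.
  rewrite mulrBr mulr1 mulNr opprK -exprD addrC; congr (_ + 'X^_).
  by have := ltn_ord i; lia.
have -> : \prod_(i < k) ('X^(rect_row k r (k + j) + (k + j)) - 'X^(rect_row k r i + i))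
  = \prod_(i < k) ('X^(r + (k + j)) - 'X^i) :> {poly R}.
  by apply: eq_bigr => i _; rewrite x_hi x_lo.
by rewrite factor [\prod_(i < k) ('X^(k + j) - _)](factor 0%N); ring.
Qed.

Lemma one_subX_neq0 m : (0 < m)%N -> 1 - 'X^m != 0 :> {poly R}.
Proof.
move=> m0; rewrite subr_eq0; apply/eqP => /(congr1 (horner^~ 0)).
by rewrite hornerXn hornerC expr0n gtn_eqF //= => /eqP; rewrite oner_eq0.
Qed.

Lemma box_prod_neq0 k d r : box_prod k d r != 0.
Proof.
apply/prodf_neq0 => j _; apply/prodf_neq0 => i _; apply: one_subX_neq0.
by have := ltn_ord i; lia.
Qed.

(** All factors have constant term 1. *)
Lemma coprimeX_box_prod k d m : coprimep 'X^m (box_prod k d 0).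
Proof.
apply: coprimep_expl; rewrite coprimep_sym -['X]subr0 -polyC0 coprimep_XsubC.
rewrite /root /box_prod horner_prod; apply/prodf_neq0 => j _.
rewrite horner_prod; apply/prodf_neq0 => i _.
rewrite hornerD hornerN hornerXn hornerC expr0n gtn_eqF ?subr0 ?oner_eq0 //.
by have := ltn_ord i; lia.
Qed.

Lemma vdm_Xn_neq0 n : vdm n (fun j => 'X^j : {poly R}) != 0.
Proof.
apply/prodf_neq0 => j _; apply/prodf_neq0 => i _.
rewrite subr_eq0; apply/eqP => /(congr1 (fun p : {poly R} => size p)) /eqP.
by rewrite !size_polyXn eqSS gtn_eqF.
Qed.

Definition rect_gf k d r : {poly R} := gt_gf R r (k + d) (rect_row k r).

Lemma rect_gfE k d r :
  rect_gf k d r * box_prod k d 0 = 'X^(r * \sum_(j < d) j) * box_prod k d r.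
Proof.
apply: (mulfI (vdm_Xn_neq0 (k + d))); rewrite -vdm_rect mulrA gt_gf_vdm //.
  by move=> j _; rewrite /rect_row; case: ifP.
by move=> j _; rewrite /rect_row; case: ifP => // jk; rewrite ifF //; lia.
Qed.

(** Since the denominator of the box product is coprime to q, the power of q in [rect_gfE] divides
    the generating function of the patterns.  The quotient is the box product
    ratio as a polynomial. *)
Lemma rect_gf_divX k d r : {H : {poly R} |
  rect_gf k d r = 'X^(r * \sum_(j < d) j) * H &
  H * box_prod k d 0 = box_prod k d r}.
Proof.
have dvd : 'X^(r * \sum_(j < d) j) %| rect_gf k d r.
  by rewrite -(Gauss_dvdpl _ (coprimeX_box_prod k d _)) rect_gfE dvdp_mulr.
exists (rect_gf k d r %/ 'X^(r * \sum_(j < d) j)).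
  by rewrite mulrC divpK.
have X0 : 'X^(r * \sum_(j < d) j) != 0 :> {poly R} by rewrite expf_neq0 ?polyX_eq0.
by apply: (mulfI X0); rewrite -rect_gfE mulrA ['X^_ * _]mulrC divpK.
Qed.

End Box.

(** * Hoggatt numbers *)

Section Hoggatt.
Variable R : realType.
Local Notation q := (qvar R).

Lemma one_subq_neq0 m : (0 < m)%N -> 1 - q ^+ m != 0.
Proof.
by move=> m0; rewrite /qvar -tofracXn -tofrac1 -tofracB tofrac_eq0 one_subX_neq0.
Qed.

Lemma qnum_neq0 m : (0 < m)%N -> qnum R m != 0.
Proof.
by move=> m0; rewrite mulf_neq0 ?invr_eq0 ?one_subq_neq0 // (@one_subq_neq0 1).
Qed.

Lemma qfact_neq0 m : qfact R m != 0.
Proof.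
rewrite /qfact big_add1 /= big_mkord; apply/prodf_neq0 => i _; exact: qnum_neq0.
Qed.

Lemma qfactS m : qfact R m.+1 = qfact R m * qnum R m.+1.
Proof. by rewrite /qfact big_nat_recr. Qed.

Lemma qfactD k m : qfact R (k + m) = qfact R m * \prod_(i < k) qnum R (k + m - i).
Proof.
elim: k => [|k IH]; first by rewrite big_ord0 mulr1.
by rewrite addSn qfactS IH big_ord_recl subn0 -mulrA [_ * qnum _ _]mulrC.
Qed.

Lemma qbinomD k m :
  qbinom R (k + m) k = (\prod_(i < k) qnum R (k + m - i)) / qfact R k.
Proof.
rewrite /qbinom qfactD addKn [qfact R k * _]mulrC -mulf_div divff ?mul1r ?qfact_neq0 //.

Qed.

(** In the quotient of q-binomials of index j the factorials of k cancel, and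
    both numerators are falling products of k factors. *)
Lemma hoggatt_box_prod d k r : hoggatt R d (k + r) k =
  q ^+ (d * 'C(k, 2)) * ((box_prod R k d r)%:F / (box_prod R k d 0)%:F).
Proof.
rewrite /hoggatt big_mkord; congr (_ * _).
rewrite /box_prod !rmorph_prod -prodf_div; apply: eq_bigr => j _.
rewrite -addnA !qbinomD -mulf_div divff ?invr_eq0 ?qfact_neq0 // mulr1.
rewrite !rmorph_prod -!prodf_div; apply: eq_bigr => i _.
rewrite /qnum -mulf_div divff ?mulr1; last first.
  by rewrite invr_eq0 (@one_subq_neq0 1).
rewrite !rmorphB !rmorphXn !rmorph1 addn0 -/(qvar R); congr ((1 - q ^+ _) / _).
by have := ltn_ord i; lia.
Qed.
End Hoggatt.

Section LogConcave.
Variable R : realType.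

(** For the top row made of k zeros and d copies of r, the bounds it puts on the
    cells under it are trivial except where two equal entries are adjacent;
    these cells form the sets Z and W. *)
Lemma rect_gf_op_gf k d r :
  rect_gf R k d r =
  op_gf R (fun p q : tri (k + d) => below (tri_coord p) (tri_coord q))
    [pred p | ((tri_coord p).1.+1 == k + d)%N && ((tri_coord p).2.+1 < k)%N]
    [pred p | ((tri_coord p).1.+1 == k + d)%N && (k <= (tri_coord p).2)%N] r.
Proof.
apply: eq_bigl => f.
apply/gt_patternP/op_mapsP => -[mono bd]; split=> // p.
  rewrite /=; case: eqP => [/bd|_]; last by rewrite /= -ltnS ltn_ord.
  by rewrite /rect_row /=; do 2!case: ltnP.
move=> /eqP Ep; have := bd p; rewrite /= Ep /rect_row /=.
by do 2!case: ltnP => ? /=.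
Qed.

Lemma rect_gf_log_concave k d r s : (s < r)%N ->
  rect_gf R k d r * rect_gf R k d s.+1 - rect_gf R k d r.+1 * rect_gf R k d s
    \is a polyOver Num.nneg.
Proof. by move=> sr; rewrite !rect_gf_op_gf op_gf_strong_log_concave. Qed.

Lemma polyOver_nneg_mulXn m (p : {poly R}) :
  ('X^m * p \is a polyOver Num.nneg) = (p \is a polyOver Num.nneg).
Proof.
apply/polyOverP/polyOverP => pp i; last first.
  by rewrite coefXnM; case: ifP => // _; rewrite nnegrE.
by have := pp (m + i)%N; rewrite coefXnM ltnNge leq_addr addKn.
Qed.

End LogConcave.

Theorem theorem1p4 (R : realType) (d k : nat) (hd : (1 <= d)%N) :
  exists a : nat -> {poly R},
    (forall n : nat, (k <= n)%N -> (a n)%:F = hoggatt R d n k) /\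
    strongly_q_log_concave (fun n : nat => (k <= n)%N) a.
Proof.
have [H HE HB] := all_sig2 (rect_gf_divX R k d).
exists (fun n => 'X^(d * 'C(k, 2)) * H (n - k)%N); split=> [n kn|i j ji _ _ _ kj].
  rewrite -{2}(subnKC kn) hoggatt_box_prod -HB !tofracM !tofracXn mulfK //.
  by rewrite tofrac_eq0 box_prod_neq0.
have -> : (i.+1 - k = (i - k).+1)%N by lia.
have -> : (j.+1 - k = (j - k).+1)%N by lia.
have sr : (j - k < i - k)%N by lia.
have := rect_gf_log_concave R k d sr; rewrite !HE.
move: (i - k)%N (j - k)%N => r s.
have regroup a b a' b' (x y x' y' : {poly R}) : (a + b = a' + b')%N ->
    'X^a * x * ('X^b * y) - 'X^a' * x' * ('X^b' * y') =
    'X^(a + b) * (x * y - x' * y').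
  by move=> ab; rewrite mulrACA [X in _ - X]mulrACA -!exprD ab mulrBr.
by rewrite !regroup ?polyOver_nneg_mulXn //; lia.
Qed.
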